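(* Let $k$ be an algebraically closed field of characteristic $p>0$. Let $G$ be a finite group of order prime to $p$, $H$ a subgroup of $G$, $V$ an irreducible projective representation of $H$ over $k$ satisfying $\dim V=|H|^{1/2}$, and $u\in G$ a central element of order $\le 2$. Then the triangular Hopf algebra $F(G,H,V,u)$ is minimal if and only if $G$ is generated by $H$ and $u$.
   Context: A finite-dimensional triangular Hopf algebra $(A,R)$ is minimal if the left (and right) tensor components of $R$ span $A$, i.e. $\{(f\otimes I)(R): f\in A^*\}=A=\{(I\otimes f)(R): f\in A^*\}$. Twists. A twist for a Hopf algebra $A$ over $k$ is an invertible element $J\in A\otimes A$ with $(\Delta\otimes I)(J)\,J_{12}=(I\otimes\Delta)(J)\,J_{23}$ and $(\varepsilon\otimes I)(J)=(I\otimes\varepsilon)(J)=1$, where $J_{12}=J\otimes 1$, $J_{23}=1\otimes J$ and $I$ is the identity map. The twisted Hopf algebra $A^J$ is $A$ as an algebra, with the same counit and coproduct $\Delta^J(x)=J^{-1}\Delta(x)J$. If $A$ is triangular with universal $R$-matrix $R$, then $A^J$ is triangular with universal $R$-matrix $J_{21}^{-1}RJ$, where $J_{21}$ is $J$ with its tensor factors exchanged. A group algebra is triangular with $R=1\otimes 1$. Twist attached to $(H,V)$. Let $H$ be a finite group with $|H|$ not divisible by the characteristic of $k$, and $V$ an irreducible projective representation of $H$ over $k$, given by $\pi:H\to PGL(V)$, with $\dim V=|H|^{1/2}$. Then $H$ acts on the algebra $End_k(V)$ by conjugation via $\pi$, and hence on the dual coalgebra $(End_kV)^*$ (with comultiplication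 $\Delta$ dual to the multiplication of $End_k V$); both are isomorphic to the regular representation of $H$. Choose $\lambda\in(End_kV)^*$ such that $\{a\cdot\lambda: a\in H\}$ is a basis of $(End_kV)^*$ and $\langle\lambda,\mathrm{id}_V\rangle=1$. Write $\Delta(\lambda)=\sum_{a,b\in H}\gamma(a,b)\,a\cdot\lambda\otimes b\cdot\lambda$ and set $J=\sum_{a,b\in H}\gamma(a,b)\,a\otimes b\in k[H]\otimes k[H]$. This is a twist for $k[H]$, and different choices of $\lambda$ give gauge equivalent twists (twists $J$ and $\Delta(x)J(x^{-1}\otimes x^{-1})$, $x$ invertible in $k[H]$, are gauge equivalent). The assignment $F$. For a finite group $G\supseteq H$ whose order is not divisible by the characteristic of $k$, $F(G,H,V)=(k[G]^J,J_{21}^{-1}J)$. For a central element $u\in G$ of order $\le 2$ set $R_u=\frac12(1\otimes 1+1\otimes u+u\otimes 1-u\otimes u)$ if $k$ does not have characteristic $2$, and $R_u=1\otimes 1$ if $k$ has characteristic $2$ (in which case $u=1$, since $|G|$ is odd). With $(A,R)=F(G,H,V)$, define $F(G,H,V,u)=(A,RR_u)$, considered up to isomorphism of triangular Hopf algebras. *)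

(* Defs.v *)
From HB Require Import structures.
From mathcomp Require Import all_boot all_order all_algebra all_fingroup.
From mathcomp Require Import all_solvable all_field.

Set Implicit Arguments.
Unset Strict Implicit.
Unset Printing Implicit Defensive.

Import GRing.Theory.
Local Open Scope ring_scope.

(* The group algebra k[G]. This is a new name for {ffun G -> k^o} because the
   product is convolution, not the pointwise one. *)
Section GroupAlgebra.
Variables (k : fieldType) (G : finGroupType).

Definition galg : Type := {ffun G -> k^o}.

HB.instance Definition _ := Vector.copy galg {ffun G -> k^o}.

Definition galg_elt (g : G) : galg := [ffun h => (h == g)%:R].
Definition galg_mul (x y : galg) : galg :=
  [ffun g => \sum_h (x h : k) * (y (h^-1 * g)%g : k)].

Fact galg_mulA : associative galg_mul.
Proof.
move=> x y z; apply/ffunP => g; rewrite !ffunE.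
under eq_bigr => h _ do rewrite ffunE big_distrr /=.
under [RHS]eq_bigr => h _ do rewrite ffunE big_distrl /=.
rewrite [RHS]exchange_big /=; apply: eq_bigr => h _.
rewrite [RHS](reindex_inj (mulgI h)) /=; apply: eq_bigr => i _.
by rewrite mulKg invMg -mulgA mulrA.
Qed.

Fact galg_mul1l : left_id (galg_elt 1%g) galg_mul.
Proof.
move=> x; apply/ffunP => g; rewrite ffunE (bigD1 1%g) //= ffunE eqxx mul1r.
rewrite invg1 mul1g big1 ?addr0 // => h /negPf hn.
by rewrite ffunE hn mul0r.
Qed.

Fact galg_mul1r : right_id (galg_elt 1%g) galg_mul.
Proof.
move=> x; apply/ffunP => g; rewrite ffunE (bigD1 g) //= ffunE mulVg eqxx mulr1.
rewrite big1 ?addr0 // => h hn; rewrite ffunE -eq_mulVg1.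
by rewrite (negPf hn) mulr0.
Qed.

Fact galg_mulDl : left_distributive galg_mul +%R.
Proof.
move=> x y z; apply/ffunP => g; rewrite !ffunE -big_split /=.
by apply: eq_bigr => h _; rewrite ffunE mulrDl.
Qed.

Fact galg_mulDr : right_distributive galg_mul +%R.
Proof.
move=> x y z; apply/ffunP => g; rewrite !ffunE -big_split /=.
by apply: eq_bigr => h _; rewrite ffunE mulrDr.
Qed.

Fact galg_1_neq0 : galg_elt 1%g != 0.
Proof.
apply/eqP => /ffunP /(_ 1%g) /eqP; rewrite !ffunE eqxx.
by rewrite oner_eq0.
Qed.

HB.instance Definition _ := GRing.Zmodule_isNzRing.Build galg
  galg_mulA galg_mul1l galg_mul1r galg_mulDl galg_mulDr galg_1_neq0.

Fact galg_scaleAl (c : k) (x y : galg) : c *: (x * y) = (c *: x) * y.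
Proof.
apply/ffunP => g; rewrite !ffunE scaler_sumr.
by apply: eq_bigr => h _; rewrite ffunE; apply: scalerAl.
Qed.
HB.instance Definition _ := GRing.Lmodule_isLalgebra.Build k galg galg_scaleAl.

Fact galg_scaleAr (c : k) (x y : galg) : c *: (x * y) = x * (c *: y).
Proof.
apply/ffunP => g; rewrite !ffunE scaler_sumr.
by apply: eq_bigr => h _; rewrite ffunE; apply: mulrCA.
Qed.
HB.instance Definition _ := GRing.Lalgebra_isAlgebra.Build k galg galg_scaleAr.

(* Provides the inverse x^-1 used below for J and J_21. *)
HB.instance Definition _ := Algebra_isFalgebra.Build k galg.

End GroupAlgebra.

(* The tensor square k[G] (x) k[G] is represented as the group algebra of
   G x G, with g (x) h the group element (g, h). *)
Section TriangularStructures.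
Variables (k : fieldType) (G : finGroupType).

Local Notation A := (galg k G).
Local Notation AA := (galg k (G * G)%type).

Definition tens (g h : G) : AA := galg_elt k (g, h).

Definition tens_swap (T : AA) : AA := [ffun q => T (q.2, q.1)].

(* (f (x) I)(T) and (I (x) f)(T), under k (x) A = A = A (x) k *)
Definition slice_l (f : 'Hom(A, k^o)) (T : AA) : A :=
  \sum_g \sum_h (T (g, h) * f (galg_elt k g)) *: galg_elt k h.
Definition slice_r (f : 'Hom(A, k^o)) (T : AA) : A :=
  \sum_g \sum_h (T (g, h) * f (galg_elt k h)) *: galg_elt k g.

(* Structure maps of a triangular Hopf algebra whose underlying algebra is k[G];
   the axioms are not bundled, and the antipode is determined by the rest. *)
Record triangular_data := TriangularData {
  coproduct : A -> AA;
  counit : A -> k;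
  Rmatrix : AA
}.

Definition minimal_triangular (T : triangular_data) : Prop :=
  (forall x : A, exists f : 'Hom(A, k^o), slice_l f (Rmatrix T) = x) /\
  (forall x : A, exists f : 'Hom(A, k^o), slice_r f (Rmatrix T) = x).

Definition group_triangular : triangular_data :=
  TriangularData (fun x : A => \sum_g x g *: tens g g)
                 (fun x : A => \sum_g x g)
                 1.

Definition twisted (T : triangular_data) (J : AA) : triangular_data :=
  TriangularData (fun x => J^-1 * coproduct T x * J)
                 (counit T)
                 ((tens_swap J)^-1 * Rmatrix T * J).

Definition Ru (u : G) : AA :=
  if 2%N \in [pchar k] then tens 1%g 1%g
  else (2%:R : k)^-1 *:
         (tens 1%g 1%g + tens 1%g u + tens u 1%g - tens u u).

Definition mulR (T : triangular_data) (S : AA) : triangular_data :=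
  TriangularData (coproduct T) (counit T) (Rmatrix T * S).

End TriangularStructures.

Section ProjectiveRepresentations.
Variables (k : fieldType) (G : finGroupType) (H : {group G}) (V : vectType k).

(* Equality of the classes of f and g in PGL(V). *)
Definition pgl_eq (f g : 'End(V)) : Prop := exists2 c : k, c != 0 & f = c *: g.

(* A homomorphism H -> PGL(V), given by representatives rho a in GL(V) of the
   images of the elements a of H; the values of rho outside H are irrelevant. *)
Definition projective_repr (rho : G -> 'End(V)) : Prop :=
  {in H, forall a, lker (rho a) = 0%VS} /\
  {in H &, forall a b, pgl_eq (rho (a * b)%g) (rho a \o rho b)%VF}.

Definition projective_irr (rho : G -> 'End(V)) : Prop :=
  {:V}%VS <> 0%VS /\
  forall U : {vspace V}, {in H, forall a, (rho a @: U <= U)%VS} ->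
    U = 0%VS \/ U = {:V}%VS.

Local Notation dualEnd := ('Hom('End(V), k^o)).

(* Contragredient of the conjugation action a . T = rho a T (rho a)^-1; it only
   depends on the class of rho a in PGL(V). *)
Definition dual_act (rho : G -> 'End(V)) (a : G) (lam : dualEnd) : dualEnd :=
  linfun (fun T : 'End(V) => lam ((rho a)^-1 \o T \o rho a)%VF).

Definition twist_functional (rho : G -> 'End(V)) (lam : dualEnd) : Prop :=
  basis_of fullv [seq dual_act rho a lam | a <- enum H] /\ lam \1%VF = 1.

(* Delta(lam) = \sum_(a, b) gam a b (a . lam) (x) (b . lam), where the element
   Delta(lam) of (End V)^* (x) (End V)^* is characterised by its pairing
   <Delta(lam), S (x) T> = <lam, S T>. *)
Definition comult_coefs (rho : G -> 'End(V)) (lam : dualEnd)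
    (gam : G -> G -> k) : Prop :=
  forall S T : 'End(V),
    lam (S \o T)%VF = \sum_(a in H) \sum_(b in H)
      gam a b * (dual_act rho a lam S * dual_act rho b lam T).

Definition twistJ (gam : G -> G -> k) : galg k (G * G)%type :=
  \sum_(a in H) \sum_(b in H) gam a b *: tens k a b.

Definition FGHV (gam : G -> G -> k) : triangular_data k G :=
  twisted (group_triangular k G) (twistJ gam).

(* D is F(G, H, V, u), constructed from some admissible choice of lam. *)
Definition is_FGHVu (rho : G -> 'End(V)) (u : G) (D : triangular_data k G) :
    Prop :=
  exists (lam : dualEnd) (gam : G -> G -> k),
    [/\ twist_functional rho lam, comult_coefs rho lam gam
      & D = mulR (FGHV gam) (Ru k u)].

End ProjectiveRepresentations.

(* Main.v *)
From HB Require Import structures.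
Require Import Defs.
From mathcomp Require Import all_boot all_order all_algebra all_fingroup.
From mathcomp Require Import all_solvable all_field.

(** Write R = J_21^-1 J. Everything reduces to one question: is the matrix
    of coefficients (R R_u)(g, h), over the subgroup K generated by H and u,
    nonsingular? Since R R_u lies in k[K] (x) k[K], its slices lie in k[K],
    so minimality forces K = G; and for a square matrix nonsingularity makes
    the slices on both sides fill the whole space.

    To see R itself, let E_a (a in H) be the basis of End V dual to the basis
    (a . lam) of its dual; then End V becomes the space of functions on H, and
    right translation of functions gives operators T |-> y |> T. The identity
    Delta(lam) = sum gam(a, b) a.lam (x) b.lam says that the product of End V is
    the pointwise product of functions preceded by the action of J. Exchanging
    the factors exchanges J and J_21, whence the braided commutation rule
      S T = sum_(e, f) R(e, f) (f |> T) (e |> S)       (Rmatrix_commute).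

    Now End V is a full matrix algebra: a tensor sum Y(a, b) E_a (x) E_b is
    zero as soon as sum Y(a, b) E_a X E_b = 0 for all X (tensor_sandwich).
    By the commutation rule, the injective map which sends Y to
    X |-> sum Y(a, b) E_a X E_b factors as: first Y |-> (sum Y(a, b) E_a
    (f |> E_b))_f, then multiplication by the matrix R, then a further linear
    map. The first map is an injective endomorphism of a space of dimension
    |H|^2, hence surjective, hence the matrix R is injective
    (nondegenerate_criterion).

    The same sandwich argument shows that J is invertible (twistJ_unit). There
    X is only allowed to be one of the operators rho(x)^-1, and one needs that
    these span End V: the sum of a conjugation orbit is a scalar proportional
    to the trace, because the functionals a . lam separate operators and hence the
    invariants of H in End V are the scalars (sum_proj_conj).

    For R R_u there are two cases. If u is not in H, the matrix over K is the
    Kronecker product of R with the nonsingular matrix [[1, 1], [1, -1]] / 2.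
    If u is in H, it is central there, and u |> is conjugation by rho(u); it
    grades End V by Z/2, and R_u inserts the sign (-1)^(|S||T|) in the
    commutation rule. Since this grading is inner, the signs can be absorbed
    in the factors of the sandwich, which remains injective
    (Rmatrix_Ru_nondegenerate). *)

Set Implicit Arguments.
Unset Strict Implicit.
Unset Printing Implicit Defensive.

Import GRing.Theory.
Local Open Scope ring_scope.

(** * Linear algebra *)

Lemma linfun_linearE (k : fieldType) (U W : vectType k) (f : U -> W) :
  linear f -> linfun f =1 f.
Proof.
move=> lin_f; pose m := GRing.isLinear.Build k U W _ f lin_f.
pose g : {linear U -> W} := HB.pack f m.
exact: (lfunE g).
Qed.

Lemma square_system_solvable (k : fieldType) (I : finType) (A : {set I})
    (M : I -> I -> k) :
    (forall v : I -> k, {in A, forall i, \sum_(j in A) M i j * v j = 0} ->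
       {in A, forall j, v j = 0}) ->
  forall z : I -> k, exists v : I -> k,
    {in A, forall i, \sum_(j in A) M i j * v j = z i}.
Proof.
move=> injM z.
(* Outside A the system is completed by the identity. *)
pose F (v : {ffun I -> k^o}) : {ffun I -> k^o} :=
  [ffun i => if i \in A then \sum_(j in A) M i j * v j else v i].
have linF : linear F.
  move=> c v w; apply/ffunP=> i; rewrite !ffunE; case: ifP => // _.
  rewrite scaler_sumr -big_split; apply: eq_bigr => j _ /=.
  by rewrite !ffunE mulrDr scalerAr.
have kerF : lker (linfun F) == 0%VS.
  rewrite -subv0; apply/subvP=> v; rewrite memv_ker linfun_linearE // memv0.
  move=> /eqP/ffunP Fv0; apply/eqP/ffunP=> i; rewrite ffunE.
  have [Ai|A'i] := boolP (i \in A); last first.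
    by have := Fv0 i; rewrite !ffunE (negPf A'i).
  apply: (injM v) => // j Aj.
  by have := Fv0 j; rewrite !ffunE Aj.
have := memvf ([ffun i => z i] : {ffun I -> k^o}).
rewrite -(lker0_limgf kerF) => /memv_imgP[v _ zE].
exists v => i Ai; have /ffunP/(_ i) := zE.
by rewrite linfun_linearE // !ffunE Ai.
Qed.

(** * Group algebras and their tensor squares *)

Section GroupAlgebraLemmas.
Variables (k : fieldType) (G : finGroupType).
Implicit Types x y z : galg k G.

Lemma galg_mulE x y g : (x * y) g = \sum_h x h * y (h^-1 * g)%g.
Proof. exact: ffunE. Qed.

Lemma galg_1E g : (1 : galg k G) g = (g == 1%g)%:R.
Proof. exact: ffunE. Qed.

(** An element of k[G] acts on functions on G by pairing; products of elements
    pair with F(g h), which turns identities in k[G] into identities between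
    sums. *)
Lemma galg_pairing_mul (W : lmodType k) x y (F : G -> W) :
  \sum_g (x * y) g *: F g = \sum_g \sum_h (x g * y h) *: F (g * h)%g.
Proof.
under eq_bigr => g _ do rewrite galg_mulE scaler_suml.
rewrite exchange_big; apply: eq_bigr => g _ /=.
rewrite (reindex_inj (mulgI g)) /=; apply: eq_bigr => h _.
by rewrite mulKg.
Qed.

Definition supported (K : {set G}) x := forall g, g \notin K -> x g = 0.

Lemma supported_mul (K : {group G}) x y :
  supported K x -> supported K y -> supported K (x * y).
Proof.
move=> Kx Ky g K'g; rewrite galg_mulE big1 // => h _.
have [Kh|/Kx->] := boolP (h \in K); last by rewrite mul0r.
by rewrite Ky ?mulr0 // groupMl // groupV.
Qed.

(** In finite dimension, an injective left multiplication is onto, so it has 1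
    in its image; the right inverse so found is two-sided. *)
Lemma galg_unit_of_lreg x : (forall y, x * y = 0 -> y = 0) ->
  x \is a GRing.unit.
Proof.
move=> xI.
have lin_x : linear ( *%R x) by move=> c y z; rewrite mulrDr scalerAr.
have ker_x : lker (linfun ( *%R x)) == 0%VS.
  rewrite -subv0; apply/subvP=> y; rewrite memv_ker linfun_linearE // memv0.
  by move=> /eqP/xI->.
have := memvf (1 : galg k G); rewrite -(lker0_limgf ker_x) => /memv_imgP[y _].
rewrite linfun_linearE // => xy1.
apply/unitrP; exists y; split=> //; apply/eqP; rewrite -subr_eq0; apply/eqP/xI.
by rewrite mulrBr mulrA -xy1 mul1r mulr1 subrr.
Qed.

(** Restriction to K is a k[K]-linear projection of k[G]. It fixes x y, so y
    and its restriction have the same product with x. Applied to y = x^-1 z it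
    keeps quotients inside k[K]. *)
Lemma supported_divisor (K : {group G}) x y : x \is a GRing.unit ->
  supported K x -> supported K (x * y) -> supported K y.
Proof.
move=> Ux Kx Kxy.
pose y0 : galg k G := [ffun g => if g \in K then y g else 0].
suff -> : y = y0 by move=> g /negPf K'g; rewrite ffunE K'g.
apply: (mulrI Ux); apply/ffunP=> g; rewrite [RHS]galg_mulE.
have [Kg|K'g] := boolP (g \in K).
  rewrite galg_mulE; apply: eq_bigr => h _; rewrite ffunE.
  have [Kh|/Kx->] := boolP (h \in K); last by rewrite !mul0r.
  by rewrite groupMl ?groupV // Kg.
rewrite Kxy // big1 // => h _; rewrite ffunE.
have [Kh|/Kx->] := boolP (h \in K); last by rewrite mul0r.
by rewrite groupMl ?groupV // (negPf K'g) mulr0.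
Qed.

Lemma sum_galg_elt (W : lmodType k) (g : G) (F : G -> W) :
  \sum_h galg_elt k g h *: F h = F g.
Proof.
rewrite (bigD1 g) //= ffunE eqxx scale1r big1 ?addr0 // => h /negPf hg.
by rewrite ffunE hg scale0r.
Qed.

Lemma galg_mul_eltr (x : galg k G) (g h : G) :
  (x * galg_elt k g) h = x (h * g^-1)%g.
Proof.
rewrite galg_mulE (bigD1 (h * g^-1)%g) //= ffunE invMg invgK mulgKV eqxx mulr1.
rewrite big1 ?addr0 // => i ih; rewrite ffunE; case: eqP => [ihg|]; last first.
  by rewrite mulr0.
by case/eqP: ih; rewrite -ihg invMg invgK mulKVg.
Qed.

End GroupAlgebraLemmas.

Section TensorSquare.
Variables (k : fieldType) (G : finGroupType).
Implicit Types S T : galg k (G * G)%type.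

Lemma tens_swapM S T : tens_swap (S * T) = tens_swap S * tens_swap T.
Proof.
apply/ffunP=> -[g h]; rewrite ffunE !galg_mulE /=.
have swapI : injective (fun q : G * G => (q.2, q.1)).
  by case=> a b [c d] [-> ->].
rewrite (reindex_inj swapI) /=; apply: eq_bigr => -[a b] _.
by rewrite !ffunE.
Qed.

Lemma tens_swap1 : tens_swap (1 : galg k (G * G)%type) = 1.
Proof.
apply/ffunP=> -[g h]; rewrite ffunE !galg_1E.
by rewrite /= !xpair_eqE andbC.
Qed.

Lemma tens_swap_unit T :
  T \is a GRing.unit -> tens_swap T \is a GRing.unit.
Proof.
move=> /unitrP[S [ST TS]]; apply/unitrP; exists (tens_swap S).
by rewrite -!tens_swapM ST TS tens_swap1.
Qed.

Definition nondegenerate_on (K : {set G}) (M : G -> G -> k) :=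
  forall v : G -> k, {in K, forall g, \sum_(h in K) M g h * v h = 0} ->
    {in K, forall h, v h = 0}.

Lemma slice_lE (f : 'Hom(galg k G, k^o)) T h :
  slice_l f T h = \sum_g T (g, h) * f (galg_elt k g).
Proof.
rewrite /slice_l sum_ffunE; apply: eq_bigr => g _; rewrite sum_ffunE.
rewrite (bigD1 h) //= big1 => [|i ih]; rewrite !ffunE.
  by rewrite eqxx addr0; apply: mulr1.
by rewrite eq_sym (negPf ih) scaler0.
Qed.

Lemma slice_rE (f : 'Hom(galg k G, k^o)) T g :
  slice_r f T g = \sum_h T (g, h) * f (galg_elt k h).
Proof.
rewrite /slice_r sum_ffunE (bigD1 g) //= [X in _ + X]big1 => [|i ig].
  rewrite addr0 sum_ffunE; apply: eq_bigr => h _; rewrite !ffunE eqxx.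
  exact: mulr1.
rewrite sum_ffunE; apply: big1 => h _; rewrite !ffunE eq_sym (negPf ig).
exact: scaler0.
Qed.

Lemma functional_of_values (v : G -> k) :
  exists f : 'Hom(galg k G, k^o), forall g, f (galg_elt k g) = v g.
Proof.
pose F (x : galg k G) : k^o := \sum_g x g * v g.
have linF : linear F.
  move=> c x y; rewrite /F scaler_sumr -big_split; apply: eq_bigr => g _ /=.
  by rewrite !ffunE mulrDl -scalerAl.
exists (linfun F) => g; rewrite linfun_linearE // /F (bigD1 g) //= ffunE eqxx.
rewrite mul1r big1 ?addr0 // => h hg; rewrite ffunE (negPf hg).
exact: mul0r.
Qed.

(** Slicing one leg is the matrix, slicing the other leg its transpose; an
    injective square matrix is surjective, and then so is its transpose. *)
Lemma slices_full T : nondegenerate_on setT (fun g h => T (g, h)) ->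
  (forall x, exists f : 'Hom(galg k G, k^o), slice_l f T = x) /\
  (forall x, exists f : 'Hom(galg k G, k^o), slice_r f T = x).
Proof.
move=> nondegT; have solT := square_system_solvable nondegT.
have nondegTt : nondegenerate_on setT (fun g h => T (h, g)).
  move=> w Tw h _.
  have [v Tv] := solT (fun g => (g == h)%:R).
  have: \sum_(g in setT) \sum_(i in setT) w g * (T (g, i) * v i) = 0.
    rewrite exchange_big big1 // => i _ /=.
    transitivity ((\sum_(g in setT) T (g, i) * w g) * v i).
      by rewrite mulr_suml; apply: eq_bigr => g _; rewrite mulrA [w g * _]mulrC.
    by rewrite Tw ?inE // mul0r.
  under eq_bigr => g _ do rewrite -mulr_sumr Tv ?inE //.
  rewrite (bigD1 h) ?inE //= eqxx mulr1 big1 ?addr0 // => g /andP[_ /negPf->].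
  exact: mulr0.
have solTt := square_system_solvable nondegTt.
split=> x.
  have [v Tv] := solTt x; have [f fv] := functional_of_values v; exists f.
  apply/ffunP=> h; rewrite slice_lE -(Tv h) ?inE //.
  by apply: eq_big => [g|g _]; rewrite ?inE ?fv.
have [v Tv] := solT x; have [f fv] := functional_of_values v; exists f.
apply/ffunP=> h; rewrite slice_rE -(Tv h) ?inE //.
by apply: eq_big => [g|g _]; rewrite ?inE ?fv.
Qed.

Lemma slices_full_support (K : {group G}) T :
    (forall x, exists f : 'Hom(galg k G, k^o), slice_l f T = x) ->
  supported (setX K K) T -> K :=: [set: G].
Proof.
move=> fullT suppT; apply/eqP; rewrite eqEsubset subsetT; apply/subsetP=> g _.
have [f /ffunP/(_ g)] := fullT (galg_elt k g); rewrite slice_lE ffunE eqxx.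
apply: contra_eqT => K'g; rewrite big1 1?eq_sym ?oner_eq0 // => h _.
by rewrite suppT ?mul0r // in_setX (negPf K'g) andbF.
Qed.

End TensorSquare.

Section SupportedPairing.
Variables (k : fieldType) (G : finGroupType) (H : {group G}) (W : lmodType k).
Implicit Types (X Y : galg k (G * G)%type) (F : G -> G -> W).

Lemma sum_supported X F : supported (setX H H) X ->
  \sum_q X q *: F q.1 q.2 =
  \sum_(a in H) \sum_(b in H) X (a, b) *: F a b.
Proof.
move=> suppX; rewrite pair_big_dep [RHS]big_mkcond; apply: eq_bigr => -[a b] _.
have [Hab|H'ab] := boolP ((a, b) \in setX H H).
  by move: Hab; rewrite in_setX /= => ->.
rewrite suppX // scale0r; move: H'ab; rewrite in_setX /=.
by case: ifP.
Qed.

Lemma pairing_mul X Y F : supported (setX H H) X -> supported (setX H H) Y ->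
  \sum_(a in H) \sum_(b in H) (X * Y) (a, b) *: F a b =
  \sum_(a in H) \sum_(b in H) X (a, b) *:
     \sum_(c in H) \sum_(d in H) Y (c, d) *: F (a * c)%g (b * d)%g.
Proof.
move=> suppX suppY; rewrite -sum_supported; last exact: supported_mul.
rewrite (galg_pairing_mul X Y (fun q => F q.1 q.2)).
rewrite -(sum_supported (fun a b => \sum_(c in H) \sum_(d in H)
  Y (c, d) *: F (a * c)%g (b * d)%g)) //.
apply: eq_bigr => p _ /=; rewrite -sum_supported // scaler_sumr.
by apply: eq_bigr => q _; rewrite scalerA.
Qed.

End SupportedPairing.

(** * The element R_u *)

Section RuLemmas.
Variables (k : fieldType) (G : finGroupType).

Lemma Ru_supported (K : {group G}) u : u \in K -> supported (setX K K) (Ru k u).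
Proof.
move=> Ku q K'q.
have q_neq g h : g \in K -> h \in K -> (q == (g, h)) = false.
  by move=> Kg Kh; apply: contraNF K'q => /eqP->; rewrite in_setX Kg.
have K1 := group1 K.
rewrite /Ru; case: ifP => _; rewrite !ffunE !q_neq //.
by rewrite subr0 !addr0 scaler0.
Qed.

Lemma sum_Ru (W : lmodType k) u (F : G -> G -> W) : (2%:R : k) != 0 ->
  \sum_q Ru k u q *: F q.1 q.2 =
  2%:R^-1 *: (F 1%g 1%g + F 1%g u + F u 1%g - F u u).
Proof.
move=> two_neq0.
have -> : Ru k u = 2%:R^-1 *: (tens k 1%g 1%g + tens k 1%g u + tens k u 1%g
    - tens k u u) by rewrite /Ru inE (negPf two_neq0) andbF.
have tensE g h : F g h = \sum_q tens k g h q *: F q.1 q.2.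
  by rewrite (sum_galg_elt (g, h) (fun q => F q.1 q.2)).
rewrite !tensE -!big_split /= -sumrB scaler_sumr.
apply: eq_bigr => q _; rewrite -!scalerDl -scalerBl scalerA; congr (_ *: _).
by rewrite !ffunE.
Qed.

(** Multiplication by a group element on the right translates the coefficients
    by its inverse. *)
Lemma mul_RuE u (X : galg k (G * G)%type) g h : (2%:R : k) != 0 ->
  (X * Ru k u) (g, h) = 2%:R^-1 *
    (X (g, h) + X (g, h * u^-1)%g + X (g * u^-1, h)%g
     - X (g * u^-1, h * u^-1)%g).
Proof.
move=> two_neq0.
have -> : Ru k u = 2%:R^-1 *: (tens k 1%g 1%g + tens k 1%g u + tens k u 1%g
    - tens k u u) by rewrite /Ru inE (negPf two_neq0) andbF.
have tensE s t : (X * tens k s t) (g, h) = X (g * s^-1, h * t^-1)%g.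
  exact: galg_mul_eltr.
rewrite -scalerAr ![in LHS]mulrDr [in LHS]mulrN.
move: (tensE 1 1)%g (tensE 1 u)%g (tensE u 1)%g (tensE u u).
rewrite invg1 !mulg1 => <- <- <- <-.
move: (X * _) (X * _) (X * _) (X * _) => X1 X2 X3 X4.
by rewrite !ffunE.
Qed.
End RuLemmas.

(** * Endomorphisms as a matrix algebra *)

Section Endomorphisms.
Variables (k : fieldType) (V : vectType k).
Implicit Types (S T X : 'End(V)) (v w : V) (f : 'Hom(V, k^o)).

Lemma comp_lfun_suml (I : Type) (r : seq I) (P : pred I) (F : I -> 'End(V)) T :
  ((\sum_(i <- r | P i) F i) \o T = \sum_(i <- r | P i) (F i \o T))%VF.
Proof.
by apply: (big_morph (fun S => S \o T)%VF) => [S S'|];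
  rewrite ?comp_lfunDl ?comp_lfun0l.
Qed.

Lemma comp_lfun_sumr (I : Type) (r : seq I) (P : pred I) (F : I -> 'End(V)) T :
  (T \o (\sum_(i <- r | P i) F i) = \sum_(i <- r | P i) (T \o F i))%VF.
Proof.
by apply: (big_morph (comp_lfun T)) => [S S'|];
  rewrite ?comp_lfunDr ?comp_lfun0r.
Qed.

Lemma functional_separation v : (forall f, f v = 0) -> v = 0.
Proof.
move=> fv0; rewrite (coord_vbasis (memvf v)) big1 // => i _.
have linc : linear (coord (vbasis fullv) i : V -> k^o).
  by move=> c w w'; rewrite linearP.
have := fv0 (linfun (coord (vbasis fullv) i : V -> k^o)).
by rewrite linfun_linearE // => ->; rewrite scale0r.
Qed.

Lemma rank1_exists f v : exists X : 'End(V), forall w, X w = f w *: v.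
Proof.
have lin : linear (fun w => f w *: v).
  by move=> c w w'; rewrite linearP scalerDl scalerA.
by exists (linfun (fun w => f w *: v)) => w; rewrite linfun_linearE.
Qed.

(** S (x) T |-> (X |-> S X T) is injective on End V (x) End V. Test on X of rank
    one: it separates the two factors, since S (f (x) v) T w = f (T w) S v. *)
Lemma tensor_sandwich (I : finType) (A : {pred I}) (E T : I -> 'End(V)) :
    (forall c : I -> k, \sum_(a in A) c a *: E a = 0 ->
       {in A, forall a, c a = 0}) ->
    (forall X, (\sum_(a in A) (E a \o X \o T a))%VF = 0) ->
  {in A, forall a, T a = 0}.
Proof.
move=> freeE sand a Aa; apply/lfunP=> w; rewrite zero_lfunE.
apply: functional_separation => f.
apply: (freeE (fun a => f (T a w))) => //; apply/lfunP=> v.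
have [X XE] := rank1_exists f v.
have := congr1 (fun S : 'End(V) => S w) (sand X).
rewrite !sum_lfunE !zero_lfunE => sandw; rewrite -[RHS]sandw.
by apply: eq_bigr => b _; rewrite !comp_lfunE XE linearZ scale_lfunE.
Qed.

Local Notation b := (vbasis {:V}).

Definition endo_trace T : k := \sum_(i < \dim {:V}) coord b i (T b`_i).

Lemma endo_traceC S T : endo_trace (S \o T)%VF = endo_trace (T \o S)%VF.
Proof.
have trE S' T' : endo_trace (S' \o T')%VF =
    \sum_(i < \dim {:V}) \sum_(j < \dim {:V})
      coord b j (T' b`_i) * coord b i (S' b`_j).
  apply: eq_bigr => i _; rewrite comp_lfunE.
  rewrite {1}(coord_vbasis (memvf (T' b`_i))) !linear_sum.
  by apply: eq_bigr => j _; rewrite !linearZ.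
rewrite !trE exchange_big; apply: eq_bigr => i _; apply: eq_bigr => j _.
exact: mulrC.
Qed.

Lemma endo_trace1 : endo_trace \1%VF = (\dim {:V})%:R.
Proof.
rewrite /endo_trace (eq_bigr (fun=> 1)) ?sumr_const ?card_ord // => i _.
rewrite id_lfunE coord_free ?eqxx //.
exact: (basis_free (vbasisP _)).
Qed.

Lemma endo_trace_rank1 f v X :
  (forall w, X w = f w *: v) -> endo_trace X = f v.
Proof.
move=> XE; rewrite /endo_trace [in RHS](coord_vbasis (memvf v)) linear_sum.
by apply: eq_bigr => i _; rewrite XE !linearZ /= mulrC.
Qed.

Fact endo_trace_is_linear : linear_for *%R endo_trace.
Proof.
move=> c S T; rewrite /endo_trace mulr_sumr -big_split.
by apply: eq_bigr => i _; rewrite add_lfunE scale_lfunE linearP.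
Qed.

HB.instance Definition _ := GRing.isLinear.Build k 'End(V) k *%R endo_trace
  endo_trace_is_linear.

End Endomorphisms.

(** * Coordinates on End V given by a twist functional *)

Section TwistFunctional.
Variables (k : fieldType) (G : finGroupType) (H : {group G}) (V : vectType k).
Variables (rho : G -> 'End(V)) (lam : 'Hom('End(V), k^o)).
Hypothesis rhoP : projective_repr H rho.
Hypothesis lamP : twist_functional H rho lam.
Hypothesis dimV : (\dim {:V} ^ 2 = #|H|)%N.
Hypothesis H_neq0 : #|H|%:R != 0 :> k.
Implicit Types (S T X : 'End(V)) (a x y : G).

(** Conjugation by the inverse of rho(x), so that x |-> proj_conj x is a right
    action of H; (x . lam) is the composite of lam with it. *)
Definition proj_conj x T : 'End(V) := ((rho x)^-1 \o T \o rho x)%VF.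

(* For x in H these values are the coordinates of T in the basis of End V dual
   to the orbit of lam; they make T a function on H. *)
Local Notation co T x := (dual_act rho x lam T).

Fact proj_conj_is_linear x : linear (proj_conj x).
Proof.
move=> c S T; rewrite /proj_conj comp_lfunDr comp_lfunDl.
by rewrite -comp_lfunZr -comp_lfunZl.
Qed.
HB.instance Definition _ x := GRing.isLinear.Build k 'End(V) 'End(V) *:%R
  (proj_conj x) (proj_conj_is_linear x).

Lemma dual_actE x T : co T x = lam (proj_conj x T).
Proof.
rewrite /dual_act linfun_linearE // => c S {}T.
by rewrite -!/(proj_conj _ _) !linearP.
Qed.

Lemma rho_ker x : x \in H -> lker (rho x) == 0%VS.
Proof. by move=> Hx; apply/eqP; case: rhoP => + _; apply. Qed.

Lemma proj_conj_comp x S T : x \in H ->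
  proj_conj x (S \o T)%VF = (proj_conj x S \o proj_conj x T)%VF.
Proof.
move=> Hx; rewrite /proj_conj !comp_lfunA; congr (_ \o _ \o _)%VF.
by rewrite lker0_compfK ?rho_ker.
Qed.

Lemma proj_conj1 x : x \in H -> proj_conj x \1%VF = \1%VF.
Proof. by move=> Hx; rewrite /proj_conj comp_lfun1r lker0_compVf ?rho_ker. Qed.

(** The scalar by which rho(x y) and rho(x) rho(y) differ cancels in a
    conjugation. *)
Lemma proj_conjM x y T : x \in H -> y \in H ->
  proj_conj (x * y)%g T = proj_conj y (proj_conj x T).
Proof.
move=> Hx Hy; have [_ /(_ x y Hx Hy)[c c0 rhoE]] := rhoP.
have kerxy : lker (rho (x * y)%g) == 0%VS by rewrite rho_ker ?groupM.
rewrite -[RHS](lker0_compKf kerxy) [LHS]/proj_conj -comp_lfunA.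
congr (_ \o _)%VF; rewrite rhoE /proj_conj -!comp_lfunZl -comp_lfunZr.
congr (_ *: _).
rewrite !comp_lfunA -[(_ \o rho y \o _)%VF]comp_lfunA.
by rewrite lker0_compfV ?rho_ker // comp_lfun1r lker0_compfV ?rho_ker //
  comp_lfun1l.
Qed.

Lemma co_shift x y T : x \in H -> y \in H ->
  co T (x * y)%g = co (proj_conj x T) y.
Proof. by move=> Hx Hy; rewrite !dual_actE proj_conjM. Qed.

Lemma co1 x : x \in H -> co \1%VF x = 1.
Proof. by move=> Hx; rewrite dual_actE proj_conj1 //; case: lamP. Qed.

Lemma co_separation T : {in H, forall x, co T x = 0} -> T = 0.
Proof.
move=> coT0; apply: functional_separation => f.
case: lamP => basH _.
rewrite (coord_basis (X := in_tuple _) basH (memvf f)) sum_lfunE big1 // => i _.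
rewrite scale_lfunE /=.
have /mapP[x] := mem_nth 0 (ltn_ord i : i < size _)%N.
by rewrite mem_enum => Hx ->; rewrite coT0 // scaler0.
Qed.

Lemma co_inj S T : {in H, forall x, co S x = co T x} -> S = T.
Proof.
move=> coST; apply/eqP; rewrite -subr_eq0; apply/eqP/co_separation => x Hx.
by rewrite linearB /= coST // subrr.
Qed.

(** The coordinate map from End V to the functions on H is injective, and both
    spaces have dimension |H|. *)
Lemma dual_basis_exists : exists E : G -> 'End(V),
  {in H &, forall a x, co (E a) x = (x == a)%:R}.
Proof.
pose F T : 'rV[k]_#|H| := \row_i (co T (enum_val i)).
have linF : linear F by move=> c S T; apply/rowP=> i; rewrite !mxE linearP.
have kerF : lker (linfun F) == 0%VS.
  rewrite -subv0; apply/subvP=> T; rewrite memv_ker linfun_linearE // memv0.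
  move=> /eqP/rowP FT0; apply/eqP/co_separation => x Hx.
  by have := FT0 (enum_rank_in Hx x); rewrite !mxE enum_rankK_in.
have limF : limg (linfun F) = fullv.
  apply/eqP; rewrite eqEdim subvf limg_dim_eq ?(eqP kerF) ?capv0 //=.
  rewrite !dimvf /dim /= mul1n -dimV dimvf expnS expn1.
  exact: leqnn.
have ex a : exists T, a \in H -> {in H, forall x, co T x = (x == a)%:R}.
  have := memvf (\row_i (enum_val i == a)%:R : 'rV[k]_#|H|).
  rewrite -limF => /memv_imgP[T _ FT]; exists T => Ha x Hx.
  move/rowP/(_ (enum_rank_in Hx x)): FT.
  by rewrite linfun_linearE // !mxE enum_rankK_in // => ->.
have [E EP] := fin_all_exists ex.
by exists E => a x Ha Hx; rewrite EP.
Qed.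

(** The orbit sum C is invariant, so all coordinates of C are equal to lam(C),
    which makes C the scalar lam(C); taking traces determines it, because
    |H| = (dim V)^2 is invertible in k. *)
Lemma sum_proj_conj T :
  \sum_(x in H) proj_conj x T = ((\dim {:V})%:R * endo_trace T) *: \1%VF.
Proof.
set C := (LHS).
have C_inv x : x \in H -> proj_conj x C = C.
  move=> Hx; rewrite linear_sum [RHS](reindex_inj (mulIg x)) /=.
  apply: eq_big => [y|y Hy]; first by rewrite groupMr.
  by rewrite proj_conjM.
have CE : C = lam C *: \1%VF.
  apply: co_inj => x Hx; rewrite linearZ /= co1 // dual_actE C_inv //.
  by rewrite /GRing.scale /= mulr1.
have trC : endo_trace C = #|H|%:R * endo_trace T.
  rewrite linear_sum mulr_natl -sumr_const; apply: eq_bigr => x Hx.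
  by rewrite /= /proj_conj endo_traceC lker0_compVKf ?rho_ker //.
rewrite CE; congr (_ *: _).
have n_neq0 : (\dim {:V})%:R != 0 :> k.
  by move: H_neq0; rewrite -dimV natrX expf_eq0.
apply: (mulfI n_neq0); rewrite mulrA -expr2 -natrX dimV -trC {2}CE.
by rewrite linearZ /= endo_trace1 mulrC.
Qed.

(** The injectivity of tensor_sandwich with X restricted to the operators
    rho(x)^-1. They span End V: averaging a rank one operator over its
    conjugation orbit expresses any rank one operator through them. *)
Lemma group_sandwich (E T : G -> 'End(V)) :
    (forall c : G -> k, \sum_(a in H) c a *: E a = 0 ->
       {in H, forall a, c a = 0}) ->
    {in H, forall x, (\sum_(a in H) (E a \o (rho x)^-1 \o T a))%VF = 0} ->
  {in H, forall a, T a = 0}.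
Proof.
move=> freeE sand a Ha; apply/lfunP=> v; rewrite zero_lfunE.
apply: functional_separation => f.
have n_neq0 : (\dim {:V})%:R != 0 :> k.
  by move: H_neq0; rewrite -dimV natrX expf_eq0.
apply: (mulfI n_neq0); rewrite mulr0.
apply: (freeE (fun a => (\dim {:V})%:R * f (T a v))) => //; apply/lfunP=> w.
rewrite zero_lfunE.
have avg b : \sum_(x in H) f (rho x w) *: (rho x)^-1%VF (T b v) =
    ((\dim {:V})%:R * f (T b v)) *: w.
  have [X XE] := rank1_exists f (T b v).
  have := congr1 (fun S : 'End(V) => S w) (sum_proj_conj X).
  rewrite (endo_trace_rank1 XE) sum_lfunE scale_lfunE id_lfunE => <-.
  by apply: eq_bigr => x _; rewrite !comp_lfunE XE linearZ.
transitivity (\sum_(x in H) f (rho x w) *: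
    (\sum_(b in H) (E b \o (rho x)^-1 \o T b))%VF v); last first.
  by rewrite big1 // => x Hx; rewrite sand // zero_lfunE scaler0.
under [RHS]eq_bigr => x _ do rewrite sum_lfunE scaler_sumr.
rewrite exchange_big sum_lfunE; apply: eq_bigr => b _ /=.
rewrite scale_lfunE -linearZ -avg linear_sum; apply: eq_bigr => x _.
by rewrite !comp_lfunE /= linearZ.
Qed.

Variable E : G -> 'End(V).
Hypothesis EP : {in H &, forall a x, co (E a) x = (x == a)%:R}.

Lemma co_sumE (c : G -> k) x : x \in H -> co (\sum_(a in H) c a *: E a) x = c x.
Proof.
move=> Hx; rewrite linear_sum (bigD1 x) //= linearZ /= EP // eqxx.
rewrite [_ *: _]mulr1 big1 ?addr0 // => a /andP[Ha ax].
by rewrite linearZ /= EP // eq_sym (negPf ax) scaler0.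
Qed.

Lemma dual_basis_free (c : G -> k) :
  \sum_(a in H) c a *: E a = 0 -> {in H, forall a, c a = 0}.
Proof. by move=> cE0 a Ha; rewrite -(co_sumE c) // cE0 linear0. Qed.

(** Right translation of functions on H, carried to End V by the coordinates.
    Conjugation by rho corresponds to left translation, so the two commute. *)
Definition rtrans y T : 'End(V) := \sum_(a in H) co T (a * y)%g *: E a.

Fact rtrans_is_linear y : linear (rtrans y).
Proof.
move=> c S T; rewrite /rtrans scaler_sumr -big_split; apply: eq_bigr => a _ /=.
by rewrite linearP scalerDl scalerA.
Qed.
HB.instance Definition _ y := GRing.isLinear.Build k 'End(V) 'End(V) *:%R
  (rtrans y) (rtrans_is_linear y).

Lemma co_rtrans y T x : x \in H -> co (rtrans y T) x = co T (x * y)%g.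
Proof. exact: (co_sumE (fun a => co T (a * y)%g)). Qed.

Lemma rtransM x y T : x \in H -> rtrans (x * y)%g T = rtrans x (rtrans y T).
Proof.
move=> Hx; apply: co_inj => a Ha.
by rewrite !co_rtrans ?groupM // mulgA.
Qed.

(** Left and right translations by a central element agree. *)
Lemma rtrans_central u T : u \in 'C(H)%g -> u \in H ->
  rtrans u T = proj_conj u T.
Proof.
move=> /centP cHu Hu; apply: co_inj => a Ha.
by rewrite co_rtrans // -(cHu a Ha) co_shift.
Qed.

Lemma rtrans1 T : rtrans 1%g T = T.
Proof. by apply: co_inj => a Ha; rewrite co_rtrans // mulg1. Qed.

Variable gam : G -> G -> k.
Hypothesis gamP : comult_coefs H rho lam gam.
Local Notation J := (twistJ H gam).

Lemma twistJE a b : J (a, b) = if (a \in H) && (b \in H) then gam a b else 0.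
Proof.
rewrite /twistJ sum_ffunE.
under eq_bigr => c _ do rewrite sum_ffunE.
rewrite pair_big_dep /= big_mkcond (bigD1 (a, b)) //= big1 => [|[c d] cd].
  by rewrite !ffunE eqxx addr0 [_ *: _]mulr1.
by rewrite !ffunE eq_sym (negPf cd) scaler0 if_same.
Qed.

Lemma twistJ_supported : supported (setX H H) J.
Proof.
by case=> a b; rewrite in_setX twistJE => /negPf->.
Qed.

Lemma twist_swap_supported : supported (setX H H) (tens_swap J).
Proof.
by case=> a b; rewrite in_setX ffunE twistJE andbC => /negPf->.
Qed.

(** Multiplication of End V is the pointwise product of coordinate functions
    preceded by the right translation action of J. *)
Lemma co_comp S T x : x \in H ->
  co (S \o T)%VF x = \sum_(a in H) \sum_(b in H)
    J (a, b) *: (co S (x * a)%g * co T (x * b)%g : k^o).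
Proof.
move=> Hx; rewrite dual_actE proj_conj_comp // gamP.
apply: eq_bigr => a Ha; apply: eq_bigr => b Hb.
rewrite twistJE Ha Hb (co_shift S Hx Ha).
by rewrite (co_shift T Hx Hb).
Qed.

(** J Y = 0 says, on each coset of H x H separately, that J kills a function Z
    on H x H. By comultiplication this means that lam kills the operators
    sum Z(a, b) x(E_a) y(E_b) for all x and y in H, x and y acting by
    conjugation. As the x . lam span, sum Z(a, b) E_a y(E_b) = 0 for all y,
    and group_sandwich concludes. *)
Lemma twistJ_unit : J \is a GRing.unit.
Proof.
apply: galg_unit_of_lreg => Y JY0; apply/ffunP=> -[g h]; rewrite ffunE.
pose Z x y := Y (x^-1 * g, y^-1 * h)%g.
have shiftZ x y : x \in H -> y \in H ->
    \sum_(a in H) \sum_(b in H) J (a, b) *: (Z (x * a)%g (y * b)%g : k^o) = 0.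
  move=> Hx Hy.
  rewrite -(sum_supported (fun a b => Z (x * a)%g (y * b)%g : k^o)) //;
    last exact: twistJ_supported.
  have /ffunP/(_ (x^-1 * g, y^-1 * h)%g) := JY0.
  rewrite galg_mulE [RHS]ffunE => JYE; rewrite -[RHS]JYE.
  apply: eq_bigr => -[a b] _.
  by rewrite /Z /= !invMg -!mulgA.
have lamZ x y : x \in H -> y \in H -> lam (\sum_(a in H) \sum_(b in H)
    Z a b *: (proj_conj x (E a) \o proj_conj y (E b))%VF) = 0.
  move=> Hx Hy; rewrite -[RHS](shiftZ x y Hx Hy).
  (* E_a and E_b being dual to the orbit of lam, only the terms a = x c and
     b = y d of the comultiplication survive. *)
  rewrite linear_sum.
  under eq_bigr => a Ha do rewrite linear_sum.
  under eq_bigr => a Ha do under eq_bigr => b Hb do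
    rewrite linearZ /= gamP scaler_sumr.
  under eq_bigr => a Ha do rewrite exchange_big /=.
  rewrite exchange_big /=; apply: eq_bigr => c Hc.
  under eq_bigr => a Ha do under eq_bigr => b Hb do rewrite scaler_sumr.
  under eq_bigr => a Ha do rewrite exchange_big /=.
  rewrite exchange_big /=; apply: eq_bigr => d Hd.
  rewrite (bigD1 (x * c)%g) ?groupM //= (bigD1 (y * d)%g) ?groupM //=.
  rewrite twistJE Hc Hd -!co_shift // !EP ?groupM // !eqxx.
  rewrite big1 => [|b /andP[Hb bd]]; last first.
    by rewrite -!co_shift // !EP ?groupM // [(y * d)%g == b]eq_sym
      (negPf bd) !mulr0 scaler0.
  rewrite big1 => [|a /andP[Ha ac]]; last first.
    rewrite big1 // => b Hb.
    by rewrite -!co_shift // !EP ?groupM // [(x * c)%g == a]eq_sym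
      (negPf ac) mul0r mulr0 scaler0.
  by rewrite !addr0 !mulr1 /GRing.scale /= mulrC.
pose T a : 'End(V) := \sum_(b in H) Z a b *: E b.
suff T0 : {in H, forall a, T a = 0}.
  have := dual_basis_free (T0 1%g (group1 H)) (group1 H).
  by rewrite /Z invg1 !mul1g.
have sand y : y \in H ->
    \sum_(a in H) (E a \o proj_conj y (T a))%VF = 0.
  move=> Hy; apply: co_separation => x Hx.
  rewrite -[RHS](lamZ x (y * x)%g) ?groupM // dual_actE; congr (lam _).
  rewrite linear_sum; apply: eq_bigr => a Ha.
  rewrite /= proj_conj_comp // -proj_conjM // linear_sum.
  rewrite comp_lfun_sumr; apply: eq_bigr => b Hb.
  by rewrite linearZ comp_lfunZr.
apply: (group_sandwich dual_basis_free) => y Hy.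
have ker_y := rho_ker Hy.
rewrite -[LHS](lker0_compfK ker_y) -[RHS](comp_lfun0l _ (rho y)^-1%VF).
congr (_ \o _)%VF; rewrite -[RHS](sand y Hy) comp_lfun_suml.
apply: eq_bigr => a _.
by rewrite /proj_conj !comp_lfunA.
Qed.

Local Notation R := ((tens_swap J)^-1 * J).

Lemma Rmatrix_supported : supported (setX H H) R.
Proof.
have swapU := tens_swap_unit twistJ_unit.
apply: (supported_divisor swapU); first exact: twist_swap_supported.
by rewrite mulVKr //; apply: twistJ_supported.
Qed.

(** The braided commutativity of End V: J = J_21 R, and J_21 is the action that
    multiplies in the opposite order. *)
Lemma Rmatrix_commute S T :
  (S \o T)%VF = \sum_(e in H) \sum_(f in H)
    R (e, f) *: (rtrans f T \o rtrans e S)%VF.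
Proof.
apply: co_inj => x Hx; rewrite co_comp //.
have swapU := tens_swap_unit twistJ_unit.
rewrite -[in LHS](mulVKr swapU J).
rewrite (pairing_mul (fun a b => co S (x * a)%g * co T (x * b)%g : k^o));
  [| exact: twist_swap_supported | exact: Rmatrix_supported].
rewrite linear_sum; under [RHS]eq_bigr => e He do rewrite linear_sum.
under [RHS]eq_bigr => e He do under eq_bigr => f Hf do
  rewrite linearZ /= co_comp // scaler_sumr.
under [RHS]eq_bigr => e He do rewrite exchange_big /=.
rewrite [RHS]exchange_big /= [LHS]exchange_big /=; apply: eq_bigr => a Ha.
under [RHS]eq_bigr => e He do under eq_bigr => f Hf do rewrite scaler_sumr.
under [RHS]eq_bigr => e He do rewrite exchange_big /=.
rewrite [RHS]exchange_big /=; apply: eq_bigr => b Hb.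
rewrite scaler_sumr; apply: eq_bigr => e He; rewrite scaler_sumr.
apply: eq_bigr => f Hf; rewrite ffunE /= !co_rtrans ?groupM //.
rewrite !mulgA /GRing.scale /= mulrCA; congr (_ * (_ * _)).
exact: mulrC.
Qed.

(** Each operator f |> acts on the second factor only, so that a sandwich
    twisted by M depends on Y only through W Y f = sum Y(a, b) E_a (f |> E_b),
    contracted with M. If the sandwich is injective then so is W, and W is then
    surjective by dimension. A vector v in the kernel of M is therefore realised
    by some Y with W Y f = v(f), whose sandwich vanishes: so Y = 0 and v = 0. *)
Lemma nondegenerate_criterion (M : G -> G -> k) :
    (forall Y : G -> G -> k,
       (forall X, \sum_(a in H) \sum_(b in H) Y a b *:
          (E a \o \sum_(e in H) \sum_(f in H)
             M e f *: (rtrans f (E b) \o rtrans e X))%VF = 0) ->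
       {in H &, forall a b, Y a b = 0}) ->
  nondegenerate_on H M.
Proof.
pose W (Y : G -> G -> k) f : 'End(V) :=
  \sum_(a in H) \sum_(b in H) Y a b *: (E a \o rtrans f (E b))%VF.
have sandE Y X : \sum_(a in H) \sum_(b in H) Y a b *:
      (E a \o \sum_(e in H) \sum_(f in H)
         M e f *: (rtrans f (E b) \o rtrans e X))%VF =
    \sum_(e in H) \sum_(f in H) M e f *: (W Y f \o rtrans e X)%VF.
  under eq_bigr => a Ha do under eq_bigr => b Hb do
    rewrite comp_lfun_sumr scaler_sumr.
  under eq_bigr => a Ha do rewrite exchange_big /=.
  rewrite exchange_big; apply: eq_bigr => e He /=.
  under eq_bigr => a Ha do under eq_bigr => b Hb do
    rewrite comp_lfun_sumr scaler_sumr.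
  under eq_bigr => a Ha do rewrite exchange_big /=.
  rewrite exchange_big; apply: eq_bigr => f Hf /=.
  rewrite comp_lfun_suml scaler_sumr; apply: eq_bigr => a Ha.
  rewrite comp_lfun_suml scaler_sumr; apply: eq_bigr => b Hb.
  by rewrite -comp_lfunZr -comp_lfunZl !scalerA mulrC comp_lfunA.
move=> injM v Mv.
pose P (i j : G * G) : k := co (E j.1 \o rtrans i.2 (E j.2))%VF i.1.
have PE (Y : G * G -> k) x f :
    \sum_(j in setX H H) P (x, f) j * Y j = co (W (fun a b => Y (a, b)) f) x.
  rewrite linear_sum; under [RHS]eq_bigr => a Ha do rewrite linear_sum.
  rewrite pair_big; apply: eq_big => -[a b]; rewrite in_setX //= => _.
  by rewrite linearZ /=; apply: mulrC.
have solP : forall z, exists Y : G * G -> k,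
    {in setX H H, forall i, \sum_(j in setX H H) P i j * Y j = z i}.
  apply: square_system_solvable => Y PY0 -[a b].
  rewrite in_setX => /andP[Ha Hb].
  apply: (injM (fun a b => Y (a, b))) => // X; rewrite sandE.
  rewrite big1 // => e He; rewrite big1 // => f Hf.
  rewrite (_ : W _ f = 0) ?comp_lfun0l ?scaler0 //.
  apply: co_separation => x Hx; rewrite -PE PY0 //.
  by rewrite in_setX Hx.
have [Y PY] := solP (fun i => v i.2).
have WE f : f \in H -> W (fun a b => Y (a, b)) f = v f *: \1%VF.
  move=> Hf; apply: co_inj => x Hx.
  rewrite -PE PY ?in_setX ?Hx // linearZ /= co1 //.
  by rewrite [_ *: _]mulr1.
have Y0 : {in H &, forall a b, Y (a, b) = 0}.
  apply: injM => X; rewrite sandE big1 // => e He.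
  under eq_bigr => f Hf do
    rewrite WE // -comp_lfunZl comp_lfun1l scalerA.
  by rewrite -scaler_suml Mv // scale0r.
move=> f Hf; have H1 := group1 H.
have := WE f Hf; rewrite /W big1 => [|a Ha]; last first.
  by rewrite big1 // => b Hb; rewrite Y0 // scale0r.
move/(congr1 (fun T => co T 1%g)); rewrite linear0 linearZ /= co1 //.
by rewrite [_ *: _]mulr1.
Qed.

(** By commutation the sandwich twisted by R is the plain one. *)
Lemma Rmatrix_nondegenerate : nondegenerate_on H (fun e f => R (e, f)).
Proof.
apply: nondegenerate_criterion => Y sandY a b Ha Hb.
apply: (dual_basis_free (c := Y a)) => //.
apply: (tensor_sandwich dual_basis_free
  (T := fun a => \sum_(b in H) Y a b *: E b)).
  move=> X; rewrite -[RHS](sandY X); apply: eq_bigr => c Hc.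
  rewrite comp_lfun_sumr; apply: eq_bigr => d Hd.
  by rewrite -comp_lfunZr -Rmatrix_commute comp_lfunA.
exact: Ha.
Qed.

Variable u : G.
Hypothesis Hu : u \in H.
Hypothesis cHu : u \in 'C(H)%g.
Hypothesis uu1 : (u * u = 1)%g.
Hypothesis two_neq0 : (2%:R : k) != 0.
Local Notation conj_u := (proj_conj u).

(** The commutation rule with a sign: X T if T is even for conjugation by
    rho(u), and conj_u(X) T if T is odd, extended by linearity. *)
Lemma Rmatrix_Ru_commute X T :
  \sum_(e in H) \sum_(f in H)
     (R * Ru k u) (e, f) *: (rtrans f T \o rtrans e X)%VF =
  2%:R^-1 *:
    ((X \o (T + conj_u T))%VF + (conj_u X \o (T - conj_u T))%VF).
Proof.
have suppR : supported (setX H H) R by apply: Rmatrix_supported.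
rewrite (pairing_mul (fun e f => (rtrans f T \o rtrans e X)%VF)) //; last first.
  exact: Ru_supported.
under eq_bigr => e He do under eq_bigr => f Hf do
  rewrite -(sum_supported (fun c d =>
     (rtrans (f * d)%g T \o rtrans (e * c)%g X)%VF) (Ru_supported k Hu))
    (sum_Ru _ (fun c d => (rtrans (f * d)%g T \o rtrans (e * c)%g X)%VF))
    // !mulg1 !rtransM // !(rtrans_central _ cHu Hu)
    scalerA mulrC -scalerA.
under eq_bigr => e He do rewrite -scaler_sumr.
rewrite -scaler_sumr; congr (_ *: _).
under eq_bigr => e He do under eq_bigr => f Hf do
  rewrite scalerBr !scalerDr.
under eq_bigr => e He do rewrite sumrB !big_split /=.
rewrite sumrB !big_split /=.
rewrite -!Rmatrix_commute.
by rewrite !comp_lfunDr comp_lfunNr !addrA.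
Qed.

(** Splitting T_a = sum_b Y(a, b) E_b in an even and an odd part, the twisted
    sandwich is the plain one for the even part plus one conjugated by the
    invertible operator rho(u) for the odd part. The two parts are separated by
    parity, and each of them is injective. *)
Lemma Rmatrix_Ru_nondegenerate :
  nondegenerate_on H (fun e f => (R * Ru k u) (e, f)).
Proof.
apply: nondegenerate_criterion => Y sandY.
pose T a : 'End(V) := \sum_(b in H) Y a b *: E b.
pose U := rho u.
have kerU : lker U == 0%VS by apply: rho_ker.
have conjK S : conj_u (conj_u S) = S.
  rewrite -proj_conjM // uu1 -rtrans_central ?group1 //.
  exact: rtrans1.
have conjU S : (S \o U = U \o conj_u S)%VF.
  by rewrite /proj_conj -comp_lfunA lker0_compVKf.
have sandT X : \sum_(a in H) (E a \o X \o (T a + conj_u (T a)))%VF +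
    \sum_(a in H) (E a \o conj_u X \o (T a - conj_u (T a)))%VF = 0.
  apply: (scalerI (invr_neq0 two_neq0)); rewrite scaler0 -[RHS](sandY X).
  rewrite -big_split scaler_sumr; apply: eq_bigr => a Ha /=.
  under [RHS]eq_bigr => b Hb do
    rewrite /= Rmatrix_Ru_commute -comp_lfunZr scalerA mulrC -scalerA
      [(E a \o _)%VF]comp_lfunDr scalerDr.
  rewrite -scaler_sumr big_split /=; congr (_ *: (_ + _)).
    rewrite linear_sum -big_split comp_lfun_sumr; apply: eq_bigr => b _ /=.
    by rewrite linearZ /= -scalerDr -comp_lfunZr comp_lfunA.
  rewrite linear_sum -sumrB comp_lfun_sumr; apply: eq_bigr => b _ /=.
  by rewrite linearZ /= -scalerBr -comp_lfunZr comp_lfunA.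
have conjp a : conj_u (T a + conj_u (T a)) = T a + conj_u (T a).
  by rewrite linearD /= conjK addrC.
have conjm a : conj_u (T a - conj_u (T a)) = - (T a - conj_u (T a)).
  by rewrite linearB /= conjK opprB.
(* Replace X by X rho(u)^-1 and multiply the sandwich by rho(u) on the right:
   this conjugates the factors T, and so changes the sign of the odd sum. *)
have sandTu X : \sum_(a in H) (E a \o X \o (T a + conj_u (T a)))%VF -
    \sum_(a in H) (E a \o conj_u X \o (T a - conj_u (T a)))%VF = 0.
  have := congr1 (fun S => S \o U)%VF (sandT (X \o U^-1)%VF).
  rewrite comp_lfun0l comp_lfunDl !comp_lfun_suml => sandXU.
  rewrite -[RHS]sandXU; congr (_ + _).
    apply: eq_bigr => a _.
    by rewrite -[RHS]comp_lfunA conjU conjp !comp_lfunA lker0_compfVK.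
  rewrite -sumrN; apply: eq_bigr => a _.
  rewrite -[RHS]comp_lfunA conjU conjm !comp_lfunNr !comp_lfunA.
  by rewrite lker0_compfVK // /proj_conj !comp_lfunA lker0_compfVK.
have Tp0 : {in H, forall a, T a + conj_u (T a) = 0}.
  apply: (tensor_sandwich dual_basis_free) => X.
  apply: (scalerI two_neq0).
  have /(congr1 (+%R^~ (\sum_(a in H) (E a \o conj_u X \o
    (T a - conj_u (T a)))%VF))) := sandTu X.
  rewrite subrK add0r => sandE.
  by have := sandT X; rewrite -sandE -mulr2n -scaler_nat scaler0.
have Tm0 : {in H, forall a, T a - conj_u (T a) = 0}.
  apply: (tensor_sandwich dual_basis_free) => X.
  have := sandT (conj_u X); rewrite conjK big1 ?add0r // => a Ha.
  by rewrite Tp0 // comp_lfun0r.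
move=> a b Ha Hb; apply: (dual_basis_free (c := Y a)) => //.
apply: (scalerI two_neq0); rewrite scaler0 scaler_nat mulr2n.
have /eqP := Tm0 a Ha; rewrite subr_eq0 => /eqP TaE.
by have := Tp0 a Ha; rewrite -TaE.
Qed.

End TwistFunctional.

(** * Adjoining the central element u *)

Lemma Ru1 (k : fieldType) (G : finGroupType) : Ru k (1%g : G) = 1.
Proof.
rewrite /Ru; have [//|] := boolP (2%N \in [pchar k]).
rewrite inE /= => two_neq0.
rewrite addrK -mulr2n -scaler_nat scalerA mulVf // scale1r.
by [].
Qed.

(** The generated group is H <u>, with at most two cosets of H. *)
Lemma joing_involution_cases (G : finGroupType) (H : {group G}) u g :
    u \in 'C(H)%g -> (u * u = 1)%g -> g \in <<u |: H>>%g ->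
  (g \in H) || (g * u \in H)%g.
Proof.
move=> cHu uu1.
have -> : <<u |: H>>%g = (H * <[u]>)%g.
  by rewrite setUC -joingE -joing_idr -cent_joinEr // cycle_subG.
case/mulsgP=> h _ Hh /cycleP[i ->] ->.
have -> : (u ^+ i = u ^+ odd i)%g.
  rewrite -{1}(odd_double_half i) expgD -muln2 mulnC expgM expgS expg1 uu1.
  by rewrite expg1n mulg1.
by case: (odd i); rewrite ?expg1 ?mulg1 -?mulgA ?uu1 ?mulg1 Hh ?orbT.
Qed.

(** Over the two cosets H and H u the matrix of X R_u has the blocks X, X, X and
    - X, up to the factor 1/2. On a kernel vector with parts v0 and v1, the two
    block rows give X (v0 + v1) = 0 and X (v0 - v1) = 0. *)
Lemma mul_Ru_nondegenerate (k : fieldType) (G : finGroupType) (H : {group G})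
    (u : G) (X : galg k (G * G)%type) :
    (2%:R : k) != 0 -> (u * u = 1)%g -> u \notin H ->
    supported (setX H H) X -> (forall g, (g \in H) || (g * u \in H)%g) ->
    nondegenerate_on H (fun e f => X (e, f)) ->
  nondegenerate_on setT (fun g h => (X * Ru k u) (g, h)).
Proof.
move=> two_neq0 uu1 H'u suppX cosets nondegX v Xv0.
have uV : (u^-1 = u)%g by apply/eqP; rewrite eq_invg_mul uu1.
have Hmulu g : g \in H -> (g * u \in H)%g = false.
  by move=> Hg; rewrite groupMl // (negPf H'u).
have notH g : (g \notin H) = (g * u \in H)%g.
  by have := cosets g; have := @Hmulu g; case: (g \in H) => [->|].
have X0l g h : g \notin H -> X (g, h) = 0.
  by move=> H'g; rewrite suppX // in_setX (negPf H'g).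
have X0r g h : h \notin H -> X (g, h) = 0.
  by move=> H'h; rewrite suppX // in_setX (negPf H'h) andbF.
have splitH (F : G -> k) :
    \sum_(h in setT) F h = \sum_(h in H) F h + \sum_(h in H) F (h * u)%g.
  rewrite (bigID (mem H)) /=; congr (_ + _).
    by apply: eq_bigl => h; rewrite inE.
  rewrite (reindex_inj (mulIg u)); apply: eq_bigl => h.
  by rewrite !inE notH -mulgA uu1 mulg1.
have mulE := mul_RuE u X _ _ two_neq0; rewrite uV in mulE.
have half_neq0 : (2%:R : k)^-1 != 0 by rewrite invr_eq0.
have even e : e \in H -> \sum_(f in H) X (e, f) * (v f + v (f * u)%g) = 0.
  move=> He; apply: (mulfI half_neq0); rewrite mulr0 -[RHS](Xv0 e) ?inE //.
  rewrite splitH -big_split mulr_sumr; apply: eq_bigr => f Hf /=.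
  rewrite !mulE -mulgA uu1 mulg1 !(X0l (e * u)%g) ?Hmulu //.
  rewrite !(X0r _ (f * u)%g) ?Hmulu // !addr0 !subr0 add0r.
  by rewrite mulrDr mulrDr !mulrA.
have odd e : e \in H -> \sum_(f in H) X (e, f) * (v f - v (f * u)%g) = 0.
  move=> He; apply: (mulfI half_neq0).
  rewrite mulr0 -[RHS](Xv0 (e * u)%g) ?inE //.
  rewrite splitH -big_split mulr_sumr; apply: eq_bigr => f Hf /=.
  rewrite !mulE -!mulgA uu1 !mulg1 !(X0l (e * u)%g) ?Hmulu //.
  rewrite !(X0r _ (f * u)%g) ?Hmulu // !add0r subr0.
  by rewrite mulrN mulNr mulrBr mulrBr !mulrA.
have evenv := nondegX (fun f => v f + v (f * u)%g) even.
have oddv := nondegX (fun f => v f - v (f * u)%g) odd.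
have vH f : f \in H -> v f = 0 /\ v (f * u)%g = 0.
  move=> Hf; have := oddv f Hf; have := evenv f Hf => /= /eqP.
  rewrite addr_eq0 => /eqP-> /eqP; rewrite -opprD oppr_eq0 -mulr2n -mulr_natl.
  by rewrite mulf_eq0 (negPf two_neq0) => /eqP->; rewrite oppr0.
move=> h _; have [/vH[]//|] := boolP (h \in H).
by rewrite notH => /vH[_]; rewrite -mulgA uu1 mulg1.
Qed.

Theorem proposition6p4 (k : closedFieldType) (p : nat) (G : finGroupType)
    (H : {group G}) (V : vectType k) (rho : G -> 'End(V)) (u : G)
    (D : triangular_data k G)
    (hp : p \in [pchar k])
    (hG : coprime #|[set: G]| p)
    (hrho : projective_repr H rho)
    (hirr : projective_irr H rho)
    (hdim : (\dim {:V} ^ 2 = #|H|)%N)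
    (hu : u \in 'Z([set: G])%g)
    (hu2 : (#[u]%g <= 2)%N)
    (hD : is_FGHVu H rho u D) :
  minimal_triangular D <-> <<u |: H>>%g = [set: G].
Proof.
have dvd_neq0 n : (n %| #|[set: G]|)%N -> n%:R != 0 :> k.
  move=> n_dvd; rewrite -(dvdn_pcharf hp); apply/negP=> p_dvd.
  move: hG; rewrite coprime_sym prime_coprime ?(pcharf_prime hp) //.
  by rewrite (dvdn_trans p_dvd n_dvd).
have H_neq0 : #|H|%:R != 0 :> k by rewrite dvd_neq0 // cardSg ?subsetT.
have uu1 : (u * u = 1)%g.
  move: hu2 (expg_order u); case: #[u]%g (order_gt0 u) => [|[|[|]]] // _ _.
  by rewrite expg1 => ->; rewrite mulg1.
have cHu : u \in 'C(H)%g.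
  by case/setIP: hu => _; apply: subsetP; apply: centS; apply: subsetT.
case: hD => lam [gam [lamP gamP ->]].
have [E EP] := dual_basis_exists lamP hdim.
rewrite /minimal_triangular /= mulr1; set R := _ * twistJ H gam.
have suppR := Rmatrix_supported hrho lamP hdim H_neq0 EP gamP.
have nondegR := Rmatrix_nondegenerate hrho lamP hdim H_neq0 EP gamP.
have Ku : u \in <<u |: H>>%g by rewrite mem_gen // setU11.
have sHK : H \subset <<u |: H>>%g by rewrite sub_gen // subsetUr.
split=> [[fullR _]|genG].
  apply: (slices_full_support fullR); apply: supported_mul.
    move=> [a b] K'q; apply: suppR; apply: contra K'q.
    by rewrite !in_setX => /andP[/(subsetP sHK)-> /(subsetP sHK)->].
  exact: (Ru_supported k (K := <<u |: H>>%G) Ku).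
apply: slices_full.
have two_neq0 : u != 1%g -> 2%:R != 0 :> k.
  move=> u1; apply: dvd_neq0; rewrite (_ : 2%N = #[u]%g) ?order_dvdG ?inE //.
  by apply/esym/nt_prime_order; rewrite // expgS expg1.
have [Hu|H'u] := boolP (u \in H); last first.
  have u1 : u != 1%g by apply: contraNneq H'u => ->.
  apply: (mul_Ru_nondegenerate _ uu1 H'u suppR _ nondegR) => //.
    exact: two_neq0.
  by move=> g; apply: (joing_involution_cases cHu uu1); rewrite genG inE.
have HG : H :=: [set: G] by rewrite -genG (setUidPr _) ?genGid ?sub1set.
rewrite -HG; have [u1|u1] := eqVneq u 1%g.
  by rewrite u1 Ru1 mulr1.
by apply: (Rmatrix_Ru_nondegenerate hrho lamP hdim H_neq0 EP gamP);
  rewrite ?two_neq0.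
Qed.
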